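(* For every $n\ge1$ there is a bijection $\Phi:\{\emptyset,1,2,\dots,n-1\}\times S_{n-1}\to S_n$ with the following properties. Let $\pi\in S_{n-1}$, $a\in\{\emptyset,1,\dots,n-1\}$, $\pi'=\Phi(a,\pi)$, and, when $a\ne\emptyset$ and $a$ is not the last entry of $\mathrm{runsort}(\pi)$, let $k$ be the entry immediately following $a$ in $\mathrm{runsort}(\pi)$. Then: (1) if $a=\emptyset$, then $\mathrm{SPV}(\pi')=\mathrm{SPV}(\pi)$; (2) if $a$ is the last entry of $\mathrm{runsort}(\pi)$, then $\mathrm{SPV}(\pi')=\mathrm{SPV}(\pi)$; (3) if $a\in\mathrm{SPV}(\pi)$, then $\mathrm{SPV}(\pi')=(\mathrm{SPV}(\pi)\setminus\{a\})\cup\{n\}$; (4) if $k\in\mathrm{SPV}(\pi)$, then $\mathrm{SPV}(\pi')=(\mathrm{SPV}(\pi)\setminus\{k\})\cup\{n\}$; (5) if $a\neq\emptyset$, $a$ is not the last entry of $\mathrm{runsort}(\pi)$, and neither $a$ nor $k$ lies in $\mathrm{SPV}(\pi)$, then $\mathrm{SPV}(\pi')=\mathrm{SPV}(\pi)\cup\{n\}$.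
   Context: For $\pi\in S_m$ in one-line notation, the runs of $\pi$ are its maximal increasing contiguous subwords, and $\mathrm{runsort}(\pi)$ is the permutation obtained by rearranging the runs of $\pi$ in lexicographic order (i.e. in increasing order of their first entries). An index $i$ with $1<i<m$ is a peak of $\pi$ if $\pi(i-1)<\pi(i)>\pi(i+1)$, and $\pi(i)$ is then a peak-value; $\mathrm{PKV}(\pi)$ is the set of peak-values, and $\mathrm{SPV}(\pi)=\mathrm{PKV}(\mathrm{runsort}(\pi))$. *)

(* Defs.v *)
From mathcomp Require Import all_boot all_fingroup.
From mathcomp Require Import finmap.
Set Implicit Arguments.
Unset Strict Implicit.
Unset Printing Implicit Defensive.

(* Entries are shifted from 'I_m = {0, .., m-1} to {1, .., m}. *)
Definition one_line (m : nat) (p : 'S_m) : seq nat :=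
  [seq (p i).+1 | i <- enum 'I_m].

Definition cons_run (x : nat) (rs : seq (seq nat)) : seq (seq nat) :=
  if rs is (y :: r) :: rs' then
    if x < y then [:: x, y & r] :: rs' else [:: x] :: rs
  else [:: [:: x]].

Definition runs (w : seq nat) : seq (seq nat) := foldr cons_run [::] w.

Lemma runs_neq_nil (w : seq nat) : [::] \notin runs w.
Proof.
elim: w => //= x w; case: (runs w) => [|[|y r] rs] //=.
by case: ifP.
Qed.

Lemma flatten_runs (w : seq nat) : flatten (runs w) = w.
Proof.
elim: w => //= x w; move: (runs_neq_nil w).
by case: (runs w) => [|[|y r] rs] //= _ <- //; case: ifP.
Qed.

(* Each run increases, and the end of a run exceeds the head of the next one
   when the word has no repeated entry, so the runs are maximal. *)
Lemma sorted_runs (w : seq nat) : all (sorted ltn) (runs w).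
Proof.
elim: w => //= x w; case: (runs w) => [|[|y r] rs] //=.
by case: ifP => //= xy /andP[-> ->]; rewrite xy.
Qed.

Lemma maximal_runs (w : seq nat) :
  sorted (fun r s : seq nat => head 0 s <= last 0 r) (runs w).
Proof.
elim: w => //= x w; move: (runs_neq_nil w).
case: (runs w) => [|[|y r] rs] //= _; case: ltnP => //= xy.
  by case: rs.
by rewrite xy.
Qed.

(* Runs of a permutation have distinct first entries, so comparing first
   entries is the lexicographic comparison. *)
Definition runsort_word (w : seq nat) : seq nat :=
  flatten (sort (fun r s : seq nat => head 0 r <= head 0 s) (runs w)).

Lemma perm_runsort_word (w : seq nat) : perm_eq (runsort_word w) w.
Proof.
by rewrite -[X in perm_eq _ X]flatten_runs perm_flatten // perm_sort.
Qed.

(* One-line notation of the run-sorted permutation. *)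
Definition runsort (m : nat) (p : 'S_m) : seq nat := runsort_word (one_line p).

(* Positions in a word are numbered from 0. *)
Definition is_peak (w : seq nat) (i : nat) : bool :=
  [&& 0 < i, i.+1 < size w, nth 0 w i.-1 < nth 0 w i
    & nth 0 w i.+1 < nth 0 w i].

Definition PKV (w : seq nat) : {fset nat} :=
  [fset nth 0 w i | i in iota 0 (size w) & is_peak w i]%fset.

Definition SPV (m : nat) (p : 'S_m) : {fset nat} := PKV (runsort p).

Definition next_entry (w : seq nat) (a k : nat) : bool := infix [:: a; k] w.

(* Main.v *)
(** Properties (1)-(5) prescribe the set SPV(Phi(a, pi)) in terms of a and pi, so
    a bijection exists as soon as, for every set T, as many pairs (a, pi) are sent
    to T by this prescription as there are pi' in S_n with SPV(pi') = T.

    To count the pi' with SPV(pi') = T, insert the values 1, 2, ..., n one by one and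
    record the runs formed so far, each being open (a larger value will follow) or
    closed.  A value v turns out to be a peak of the run-sorted word exactly when it
    closes a run whose first entry is not the largest first entry present.  The
    number of partial permutations therefore depends only on the number c of open
    runs and on whether the run with the largest first entry is open.  After the first
    step there are as many states with (c + 1, open) as with (c, closed); writing
    y_c for this number, a non-peak gives
    y'_c = (c + 1) (2 y_c + y_(c-1)) and a peak gives y'_c = (c + 1) y_(c+1).
    An induction on v then yields, with b the number of peaks among 1, ..., v and D_c
    the sum of the y_c over all ways of turning one non-peak into a peak,
    (c + 1) y_(c+1) + (1 + 2 b + c) y_c = v y_c + 2 D_c,
    whose case c = 0 is the count of the pairs (a, pi). *)
Require Import Defs.
From mathcomp Require Import all_boot all_fingroup.
From mathcomp Require Import finmap zify.
Set Implicit Arguments.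
Unset Strict Implicit.
Unset Printing Implicit Defensive.

(** * Bijections from fibers of equal size *)

Lemma bij_of_fibers (X Y : finType) (Z : eqType) (f : X -> Z) (g : Y -> Z)
    (y0 : Y) :
  (forall z, count (fun x => f x == z) (enum X) =
             count (fun y => g y == z) (enum Y)) ->
  exists Phi : X -> Y, bijective Phi /\ forall x, g (Phi x) = f x.
Proof.
move=> eq_fib.
pose FX z := [seq x <- enum X | f x == z].
pose FY z := [seq y <- enum Y | g y == z].
have szF z : size (FX z) = size (FY z) by rewrite !size_filter eq_fib.
have idxP x : index x (FX (f x)) < size (FY (f x)).
  by rewrite -szF index_mem mem_filter eqxx mem_enum.
(* [x] goes to the element of the same rank in the fiber of [g] over [f x]. Equal images lie in one
   fiber and have equal rank there, whence injectivity. *)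
pose Phi x := nth y0 (FY (f x)) (index x (FX (f x))).
have PhiE x : g (Phi x) = f x.
  have := mem_nth y0 (idxP x); rewrite mem_filter => /andP[/eqP + _].
  exact.
have injPhi : injective Phi.
  move=> x x' eqPhi; have eqf : f x = f x' by rewrite -!PhiE eqPhi.
  move/eqP: eqPhi; rewrite /Phi eqf nth_uniq //; first last.
  - by rewrite filter_uniq ?enum_uniq.
  - by rewrite -[in X in size (FY X)]eqf -[in X in FX X]eqf idxP.
  by move/eqP; apply: (index_inj x); rewrite mem_filter mem_enum ?eqf eqxx.
exists Phi; split=> //; apply: inj_card_bij => //.
(* Both cardinals are sums of fiber sizes over this common list of values, so they agree and
   injectivity suffices. *)
pose S := undup ([seq f x | x <- enum X] ++ [seq g y | y <- enum Y]).
suff cardS (T : finType) (k : T -> Z) : {subset [seq k t | t <- enum T] <= S} ->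
    #|T| = \sum_(z <- S) count (fun t => k t == z) (enum T).
  rewrite (cardS X f) ?(cardS Y g) => [|z|z]; last 2 first.
  - by rewrite mem_undup mem_cat orbC => ->.
  - by rewrite mem_undup mem_cat => ->.
  by under eq_bigr do rewrite -eq_fib.
move=> subS; rewrite cardT; under eq_bigr do rewrite -sum1_count big_mkcond.
rewrite exchange_big /= -sum1_size; apply: eq_big_seq => t t_in.
rewrite (bigD1_seq (k t)) ?undup_uniq //=; last exact/subS/map_f.
rewrite eqxx.
by rewrite big1 // => z; rewrite eq_sym => /negPf->.
Qed.

(** * Partial permutations as sequences of runs *)

(* A run, flagged [true] while it is open, i.e. when the entry that will follow it
   is a larger value still to be inserted. *)
Definition block := (bool * seq nat)%type.
(* The largest first entry of a run, the peak-values found so far, and the runs in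
   the order in which they occur in the permutation under construction. *)
Definition state := (nat * seq nat * seq block)%type.

Definition is_open (b : block) := b.1.
Definition bhead (b : block) := head 0 b.2.
Definition word (bl : seq block) := flatten (unzip2 bl).

Fixpoint open_splits (bl : seq block) : seq (seq block * seq nat * seq block) :=
  if bl is b :: bl' then
    (if is_open b then [:: ([::], b.2, bl')] else [::])
      ++ [seq (b :: t.1.1, t.1.2, t.2) | t <- open_splits bl']
  else [::].

Lemma open_splitsP (bl X : seq block) (r : seq nat) (Y : seq block) :
  reflect (bl = X ++ (true, r) :: Y) ((X, r, Y) \in open_splits bl).
Proof.
elim: bl X r Y => [|[o w] bl IH] X r Y /=; first by apply: ReflectF; case: X.
apply: (iffP idP) => [|].
  rewrite mem_cat => /orP[|/mapP[[[X' r'] Y'] /= /IH-> [-> -> ->]]] //.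
  by case: o => //; rewrite inE => /eqP[-> -> ->].
case: X => [[-> -> ->]|b X /= [-> /IH in_bl]]; first exact: mem_head.
by rewrite mem_cat; apply/orP; right; apply/mapP; exists (X, r, Y).
Qed.

Lemma count_open_splits (q : pred nat) (bl : seq block) :
  count (fun t => q (head 0 t.1.2)) (open_splits bl) =
  count (fun b => is_open b && q (bhead b)) bl.
Proof.
elim: bl => //= -[[] w] bl IH /=; rewrite ?count_cat count_map /= -IH ?addn0.
  by congr addn.
by apply: eq_count.
Qed.

(* A new run can only be placed at the front or after an open run: a closed run must
   be followed by an entry smaller than its last one. *)
Definition children (v : nat) (s : state) : seq state :=
  let: (h, pk, bl) := s in
  [:: (v, pk, (false, [:: v]) :: bl); (v, pk, (true, [:: v]) :: bl)] ++
  flatten [seq let: (X, r, Y) := t in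
    [:: (h, if head 0 r == h then pk else v :: pk, X ++ (false, rcons r v) :: Y);
        (h, pk, X ++ (true, rcons r v) :: Y);
        (v, pk, X ++ [:: (true, r), (false, [:: v]) & Y]);
        (v, pk, X ++ [:: (true, r), (true, [:: v]) & Y])] | t <- open_splits bl].

Fixpoint levels (v : nat) : seq state :=
  if v is v'.+1 then flatten [seq children v s | s <- levels v']
  else [:: (0, [::], [::])].

Definition nb_open (s : state) : nat := count is_open s.2.
(** A count rather than a boolean: it is additive over concatenation and serves as a multiplicity in
    the recurrences. It is 0 or 1 in every state reached, by [coherent_levels]. *)
Definition nb_latest (s : state) : nat :=
  count (fun b => is_open b && (bhead b == s.1.1)) s.2.

(** The bounds make [v.+1] differ from all heads and peak-values already present, so that a new run
    is the only one with the latest head; nonempty runs keep their head when extended. *)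
Definition coherent (v : nat) (s : state) : Prop :=
  [/\ nb_latest s <= 1, all (fun b => bhead b <= v) s.2,
      all (fun b => b.2 != [::]) s.2 & all (leq^~ v) s.1.2].

(* [ok i b] says whether [i] may be a peak ([b = true]) or a non-peak
   ([b = false]); it serves both to prescribe the set of peaks and to count all states. *)
Definition allowed (ok : nat -> bool -> bool) (v : nat) (pk : seq nat) : bool :=
  all (fun i => ok i (i \in pk)) (iota 1 v).

Definition in_class ok (v c f : nat) (s : state) : bool :=
  [&& allowed ok v s.1.2, nb_open s == c & nb_latest s == f].


Lemma children_inv v h pk bl (P : state -> Prop) :
  P (v, pk, (false, [:: v]) :: bl) -> P (v, pk, (true, [:: v]) :: bl) ->
  (forall X r Y, bl = X ++ (true, r) :: Y ->
   [/\ P (h, if head 0 r == h then pk else v :: pk, X ++ (false, rcons r v) :: Y),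
       P (h, pk, X ++ (true, rcons r v) :: Y),
       P (v, pk, X ++ [:: (true, r), (false, [:: v]) & Y]) &
       P (v, pk, X ++ [:: (true, r), (true, [:: v]) & Y])]) ->
  forall s, s \in children v (h, pk, bl) -> P s.
Proof.
move=> P0 P1 P2 s; rewrite /children mem_cat => /orP[|].
  by rewrite !inE => /orP[] /eqP->.
case/flatten_mapP => -[[X r] Y] /open_splitsP/P2[? ? ? ?].
by rewrite !inE => /or4P[] /eqP->.
Qed.

Lemma head_rcons (r : seq nat) v : r != [::] -> head 0 (rcons r v) = head 0 r.
Proof. by case: r. Qed.

Lemma nb_latest_fresh v (bl : seq block) :
  all (fun b => bhead b <= v) bl ->
  count (fun b => is_open b && (bhead b == v.+1)) bl = 0.
Proof.
move=> /allP le_v; apply/eqP; rewrite -leqn0 leqNgt -has_count.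
by apply/hasPn => b /le_v; lia.
Qed.

Lemma coherent_children v s s' :
  coherent v s -> s' \in children v.+1 s -> coherent v.+1 s'.
Proof.
case: s => [[h pk] bl] [/= lat hle nn pkle]; apply: children_inv => [||X r Y eq_bl].
1,2: by split; rewrite ?/nb_latest /= ?nb_latest_fresh ?eqxx //;
  try (apply/andP; split => //); first [apply: sub_all hle|apply: sub_all pkle] => ?; lia.
move: lat hle nn; rewrite /nb_latest /= {}eq_bl !count_cat !all_cat /=.
move=> lat /and3P[hX hr hY] /and3P[nX nr nY].
have {}pkle : all (leq^~ v.+1) pk by apply: sub_all pkle => ?; lia.
have wk Z : all (fun b => bhead b <= v) Z -> all (fun b => bhead b <= v.+1) Z.
  by apply: sub_all => ?; lia.
rewrite /bhead /= in hr lat.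
split; split; rewrite /nb_latest /= ?count_cat ?all_cat /= ?nX ?nr ?nY ?wk //=
  ?nb_latest_fresh /bhead /= ?head_rcons ?eqxx ?(leqW hr) ?andbT ?nil_rcons
  -?size_eq0 ?size_rcons //; try lia.
all: try by case: ifP => //= _; rewrite leqnn.
all: by rewrite size_eq0.
Qed.

Lemma coherent_levels v s : s \in levels v -> coherent v s.
Proof.
elim: v s => [|v IH] s /=; first by rewrite inE => /eqP->.
by case/flatten_mapP => t /IH; apply: coherent_children.
Qed.

Lemma count_flatten_map (T S : Type) (q : pred S) (F : T -> seq S) (l : seq T) :
  count q (flatten [seq F x | x <- l]) = \sum_(x <- l) count q (F x).
Proof. by elim: l => [|x l IH] /=; rewrite ?big_nil ?big_cons ?count_cat ?IH. Qed.


Lemma allowed_fresh ok v pk : all (leq^~ v) pk ->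
  allowed ok v.+1 pk = allowed ok v pk && ok v.+1 false.
Proof.
move=> pk_le; rewrite /allowed -[in iota _ _](addn1 v) iotaD all_cat /= andbT add1n.
by case: (boolP (v.+1 \in pk)) => // /(allP pk_le); rewrite ltnn.
Qed.

Lemma allowed_peak ok v pk :
  allowed ok v.+1 (v.+1 :: pk) = allowed ok v pk && ok v.+1 true.
Proof.
rewrite /allowed -[in iota _ _](addn1 v) iotaD all_cat /= andbT add1n mem_head.
congr andb; apply: eq_in_all => i; rewrite mem_iota inE => i_le.
by rewrite [i == _]ltn_eqF //; lia.
Qed.

Lemma sum_bool (T : Type) (q : pred T) (l : seq T) :
  \sum_(x <- l) (q x : nat) = count q l.
Proof. by rewrite -sum1_count [in RHS]big_mkcond. Qed.

(** The five terms are, in order: a new closed run, a new open run (each at the front or after one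
    of the open runs), an open run extended and left open, the latest open run closed, another open
    run closed. Only the last creates a peak. *)
Lemma count_children ok (v c f : nat) s : coherent v s ->
  count (in_class ok v.+1 c f) (children v.+1 s) =
  allowed ok v s.1.2 *
   (ok v.+1 false *
     ((nb_open s).+1 * ((nb_open s == c) && (f == 0))
      + (nb_open s).+1 * (((nb_open s).+1 == c) && (f == 1))
      + nb_open s * ((nb_open s == c) && (nb_latest s == f))
      + nb_latest s * ((nb_open s == c.+1) && (f == 0)))
    + ok v.+1 true *
       ((nb_open s - nb_latest s) * ((nb_open s == c.+1) && (nb_latest s == f)))).
Proof.
case: s => [[h pk] bl] coh; have [/= lat hle nn pkle] := coh.
rewrite /children /= count_flatten_map.
set s := (h, pk, bl); set A := allowed ok v pk.
(* The contribution of one open run, [b] telling whether its head is the latest. Closing it makes a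
   peak iff [~~ b], and lowers [nb_latest] by [b], whence [f + b]. *)
pose F (b : bool) := A * (ok v.+1 false *
   (((nb_open s == c) && (nb_latest s == f)) + ((nb_open s == c) && (f == 0)) +
    (((nb_open s).+1 == c) && (f == 1)))
  + ok v.+1 (~~ b) * ((nb_open s == c.+1) && (nb_latest s == f + b))).
have -> : \sum_(t <- open_splits bl)
     count (in_class ok v.+1 c f)
       (let: (X, r, Y) := t in
        [:: (h, if head 0 r == h then pk else v.+1 :: pk,
             X ++ (false, rcons r v.+1) :: Y);
            (h, pk, X ++ (true, rcons r v.+1) :: Y);
            (v.+1, pk, X ++ [:: (true, r), (false, [:: v.+1]) & Y]);
            (v.+1, pk, X ++ [:: (true, r), (true, [:: v.+1]) & Y])]) =
    \sum_(t <- open_splits bl) F (head 0 t.1.2 == h).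
  apply: eq_big_seq => -[[X r] Y] /open_splitsP eq_bl.
  rewrite {}/F /= addn0 /in_class /= (allowed_fresh ok pkle) -/A.
  have -> : nb_open s = (count is_open X + count is_open Y).+1.
    by rewrite /nb_open /= eq_bl count_cat /= addnS.
  have -> : nb_latest s = count (fun b => is_open b && (bhead b == h)) X +
     (head 0 r == h) + count (fun b => is_open b && (bhead b == h)) Y.
    by rewrite /nb_latest /= eq_bl count_cat /= addnA.
  move: (hle) (nn); rewrite eq_bl !all_cat /=.
  move=> /and3P[hX hr hY] /and3P[nX nr nY].
  have hrF : (head 0 r == v.+1) = false by apply/eqP => e; rewrite /bhead /= e ltnn in hr.
  rewrite /nb_open /nb_latest /= !count_cat /= !nb_latest_fresh // /bhead /=.
  rewrite !head_rcons // hrF eqxx (fun_if (allowed ok v.+1)) allowed_peak.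
  rewrite (allowed_fresh ok pkle) -/A; move: (count _ X) (count _ Y) => x y.
  move: (count _ X) (count _ Y) => x' y'.
  case: (head 0 r == h); rewrite /= -!mulnb;
    rewrite !(add0n, addn0, add1n, addn1, addnS, addSn) !eqSS !(eq_sym 0) !(eq_sym 1);
    do ![move: (nat_of_bool _) => ?]; clear; lia.
rewrite (eq_bigr (fun t =>
  (head 0 t.1.2 == h) * F true + (head 0 t.1.2 != h) * F false)); last first.
  by move=> t _; case: eqP; lia.
rewrite big_split /= -!big_distrl /= !sum_bool.
have eqlat : count (fun t => head 0 t.1.2 == h) (open_splits bl) = nb_latest s.
  exact: (count_open_splits (pred1 h)).
have eqop : count predT (open_splits bl) = nb_open s.
  rewrite (count_open_splits predT) /nb_open.
  by apply: eq_count => b; rewrite andbT.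
have eqnlat : count (fun t => head 0 t.1.2 != h) (open_splits bl) = nb_open s - nb_latest s.
  rewrite -eqop -eqlat count_predT -(count_predC (fun t => head 0 t.1.2 == h)).
  by rewrite addKn.
have le_lo : nb_latest s <= nb_open s.
  by apply: sub_count => b /andP[].
rewrite eqlat eqnlat /in_class /= (allowed_fresh ok pkle) -/A.
have -> : nb_open (v.+1, pk, (false, [:: v.+1]) :: bl) = nb_open s by [].
have -> : nb_open (v.+1, pk, (true, [:: v.+1]) :: bl) = (nb_open s).+1 by [].
have -> : nb_latest (v.+1, pk, (false, [:: v.+1]) :: bl) = 0.
  by rewrite /nb_latest /= nb_latest_fresh.
have -> : nb_latest (v.+1, pk, (true, [:: v.+1]) :: bl) = 1.
  by rewrite /nb_latest /bhead /= nb_latest_fresh ?eqxx.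
rewrite {}/F; move: lat le_lo; rewrite -/s.
move: (nb_open s) (nb_latest s) => o l l1 le_lo.
rewrite -!mulnb; move: {A}(nat_of_bool A) (nat_of_bool (ok _ _)) (nat_of_bool (ok _ _)) => A x y.
have [->|el] : l = 0 \/ l = 1 by lia.
  rewrite addn0 addn1 !(eq_sym 0) (eq_sym 1) /=.
  do ![move: (nat_of_bool _) => ?]; clear; lia.
case: o le_lo => [|o _]; first by rewrite el.
rewrite el addn0 addn1 !(eq_sym 0) !(eq_sym 1) !eqSS subn1 /=.
do ![move: (nat_of_bool _) => ?]; clear; lia.
Qed.

(** * Counting states *)

Definition nb_class ok v c f := count (in_class ok v c f) (levels v).

Lemma nb_classS ok v c f : nb_class ok v.+1 c f =
  \sum_(s <- levels v) count (in_class ok v.+1 c f) (children v.+1 s).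
Proof. by rewrite /nb_class /= count_flatten_map. Qed.

Lemma nb_classS0 ok v c : nb_class ok v.+1 c 0 =
  ok v.+1 false * (c.+1 * (nb_class ok v c 0 + nb_class ok v c 1)
                   + c * nb_class ok v c 0 + nb_class ok v c.+1 1)
  + ok v.+1 true * (c.+1 * nb_class ok v c.+1 0).
Proof.
rewrite nb_classS /nb_class -!sum_bool -big_split !big_distrr -!big_split /=.
rewrite !big_distrr -big_split /=; apply: eq_big_seq => s /coherent_levels coh.
rewrite (count_children ok c 0 coh) /in_class; case: coh => l1 _ _ _.
have [->|->] : nb_latest s = 0 \/ nb_latest s = 1 by clear -l1; lia.
all: rewrite -!mulnb; case: (eqVneq (nb_open s) c) => [->|_] /=;
  last case: (eqVneq (nb_open s) c.+1) => [->|_] /=;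
  rewrite ?(ltn_eqF (ltnSn c)) ?(gtn_eqF (ltnSn c)) /=;
  do ![move: (nat_of_bool _) => ?]; clear; lia.
Qed.

(** The peak term has factor [c.+1] although [c.+2] runs are open: closing the latest one makes no
    peak. Nor does that closing occur elsewhere, as it leaves [nb_latest] equal to 0. *)
Lemma nb_classS1 ok v c : nb_class ok v.+1 c.+1 1 =
  ok v.+1 false * (c.+1 * (nb_class ok v c 0 + nb_class ok v c 1)
                   + c.+1 * nb_class ok v c.+1 1)
  + ok v.+1 true * (c.+1 * nb_class ok v c.+2 1).
Proof.
rewrite nb_classS /nb_class -!sum_bool -big_split !big_distrr -!big_split /=.
rewrite !big_distrr -big_split /=; apply: eq_big_seq => s /coherent_levels coh.
rewrite (count_children ok c.+1 1 coh) /in_class; case: coh => l1 _ _ _; rewrite eqSS.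
have [->|->] : nb_latest s = 0 \/ nb_latest s = 1 by clear -l1; lia.
all: rewrite -!mulnb; case: (eqVneq (nb_open s) c) => [->|_] /=;
  last (case: (eqVneq (nb_open s) c.+1) => [->|_] /=;
  last case: (eqVneq (nb_open s) c.+2) => [->|_] /=);
  rewrite ?eqSS ?(ltn_eqF (ltnSn c)) ?(gtn_eqF (ltnSn c)) ?(ltn_eqF (leqnSn c.+1)) ?(gtn_eqF (leqnSn c.+1)) /=;
  do ![move: (nat_of_bool _) => ?]; clear; lia.
Qed.

Lemma nb_classS01 ok v : nb_class ok v.+1 0 1 = 0.
Proof.
rewrite nb_classS big1_seq // => s /andP[_ /coherent_levels coh].
rewrite (count_children ok 0 1 coh); case: coh => l1 _ _ _.
have [->|->] : nb_latest s = 0 \/ nb_latest s = 1 by clear -l1; lia.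
all: rewrite -!mulnb; case: (nb_open s) => [|[|o]] /=;
  do ?[move: (nat_of_bool _) => ?]; clear; lia.
Qed.

(** Both sides satisfy the same recurrence: by induction the terms [c * nb_class ok v c 0 + nb_class
    ok v c.+1 1] of one merge into the [c.+1 * nb_class ok v c.+1 1] of the other. *)
Lemma nb_class_latest ok v c : nb_class ok v.+1 c.+1 1 = nb_class ok v.+1 c 0.
Proof.
elim: v c => [|v IH] c.
  rewrite nb_classS1 nb_classS0 /nb_class /in_class /nb_open /nb_latest /=.
  by case: c => [|c]; lia.
rewrite [LHS]nb_classS1 [RHS]nb_classS0 !IH; case: c => [|c]; rewrite ?nb_classS01 ?IH;
  do ![move: (nat_of_bool _) => ?]; lia.
Qed.

(* The value v.+1 is the last one inserted, as [nb_class_latest] fails before the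
   first insertion. *)
Definition nb_closed ok v c := nb_class ok v.+1 c 0.

Lemma nb_closedS ok v c : nb_closed ok v.+1 c =
  ok v.+2 false * (c.+1 * (2 * nb_closed ok v c + (if c is c'.+1 then nb_closed ok v c' else 0)))
  + ok v.+2 true * (c.+1 * nb_closed ok v c.+1).
Proof.
rewrite /nb_closed nb_classS0 nb_class_latest.
case: c => [|c]; rewrite ?nb_classS01 ?nb_class_latest; lia.
Qed.

Lemma nb_closed0 ok c : nb_closed ok 0 c = ok 1 false && (c == 0).
Proof.
rewrite /nb_closed nb_classS0 /nb_class /in_class /nb_open /nb_latest /=.
by case: c => [|c]; lia.
Qed.

(** The recurrence reduces to two Pascal steps, C(v,c-1) + 2 C(v,c) + C(v,c+1) = C(v+2,c+1), and to
    (c+1) C(v+2,c+1) = (v+2) C(v+1,c). The case [c = 0] bounds the number of closed states in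
    [perm_closed_levels]. *)
Lemma nb_closed_total v c : nb_closed (fun _ _ => true) v c = v.+1`! * 'C(v, c).
Proof.
elim: v c => [|v IH] c; first by rewrite nb_closed0 bin0n (_ : 1`! = 1) ?mul1n.
rewrite nb_closedS !IH !mul1n (factS v.+1) -[v.+2 * _ * _]mulnA (mulnCA v.+2).
have -> : (if c is c'.+1 then nb_closed (fun=> xpredT) v c' else 0) =
          v.+1`! * (if c is c'.+1 then 'C(v, c') else 0).
  by case: c => [|c]; rewrite ?muln0 ?IH.
rewrite (mul_bin_diag v.+2 c : _ * 'C(v.+1, c) = _); move: (v.+1`!) => F.
by case: c => [|c]; rewrite !binS ?bin0; lia.
Qed.

Lemma nb_class_ext ok ok' v c f :
  {in [pred i | 0 < i <= v], ok =1 ok'} -> nb_class ok v c f = nb_class ok' v c f.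
Proof.
move=> eq_ok; apply: eq_count => s; rewrite /in_class /allowed; congr andb.
apply: eq_in_all => i; rewrite mem_iota add1n ltnS => i_v.
by rewrite eq_ok.
Qed.

(** * Prescribed peak sets and the insertion identity *)

Definition has_peaks (T : {fset nat}) (i : nat) (b : bool) : bool := b == (i \in T).

Definition nb_peaks (T : {fset nat}) v c := nb_closed (has_peaks T) v c.

Lemma nb_peaksU_gt (T : {fset nat}) s v c :
  v.+1 < s -> nb_peaks (T `|` [fset s])%fset v c = nb_peaks T v c.
Proof.
move=> sv; apply: nb_class_ext => i; rewrite inE => iv.
by rewrite /has_peaks in_fsetU in_fset1 (_ : (i == s) = false) ?orbF //; apply/eqP; lia.
Qed.

Lemma nb_peaksS (T : {fset nat}) v c : nb_peaks T v.+1 c =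
  if v.+2 \in T then c.+1 * nb_peaks T v c.+1
  else c.+1 * (2 * nb_peaks T v c + (if c is c'.+1 then nb_peaks T v c' else 0)).
Proof.
rewrite /nb_peaks nb_closedS [has_peaks _ _ false]/has_peaks [has_peaks _ _ true]/has_peaks.
by case: (_ \in T); rewrite !(mul1n, mul0n) ?addn0.
Qed.

(** The sum D_c, for the values up to [v.+1]. It will count the permutations that lose one peak when
    the new value is inserted. *)
Definition nb_more (T : {fset nat}) v c :=
  \sum_(s <- iota 1 v.+1 | s \notin T) nb_peaks (T `|` [fset s])%fset v c.

(** The extra last term is the choice [s = v.+2]: turning the newest non-peak into a peak replaces
    its step by a peak step. *)
Lemma nb_moreS (T : {fset nat}) v c : nb_more T v.+1 c =
  if v.+2 \in T then c.+1 * nb_more T v c.+1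
  else c.+1 * (2 * nb_more T v c + (if c is c'.+1 then nb_more T v c' else 0))
       + c.+1 * nb_peaks T v c.+1.
Proof.
rewrite /nb_more -[in iota _ v.+2](addn1 v.+1) iotaD big_cat add1n [iota v.+2 1]/=.
rewrite (big_cons _ _ v.+2) big_nil.
have -> : \sum_(i <- iota 1 v.+1 | i \notin T) nb_peaks (T `|` [fset i])%fset v.+1 c =
  \sum_(i <- iota 1 v.+1 | i \notin T)
    if v.+2 \in T then c.+1 * nb_peaks (T `|` [fset i])%fset v c.+1
    else c.+1 * (2 * nb_peaks (T `|` [fset i])%fset v c +
      (if c is c'.+1 then nb_peaks (T `|` [fset i])%fset v c' else 0)).
  rewrite big_seq_cond [RHS]big_seq_cond; apply: eq_bigr => i /andP[].
  rewrite mem_iota => iv _; rewrite nb_peaksS in_fsetU in_fset1.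
  by rewrite (_ : (_ == i) = false) ?orbF //; apply/eqP; lia.
case: (boolP (v.+2 \in T)) => vT; first by rewrite -big_distrr [X in X = _]addn0.
rewrite -big_distrr big_split -big_distrr /= nb_peaksS in_fsetU in_fset1 eqxx orbT.
rewrite nb_peaksU_gt // addn0; congr (_ * (_ + _) + _); case: (c) => //.
by rewrite big1_eq.
Qed.

Lemma nb_peaks_insert (T : {fset nat}) v c :
  c.+1 * nb_peaks T v c.+1
    + (1 + 2 * count (fun i => i \in T) (iota 1 v.+1) + c) * nb_peaks T v c
  = v.+1 * nb_peaks T v c + 2 * nb_more T v c.
Proof.
elim: v c => [|v IH] c.
  rewrite /nb_more /= big_cons big_nil /nb_peaks !nb_closed0 /has_peaks /=.
  rewrite in_fsetU in_fset1 eqxx orbT /= andbF.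
  by case: (1 \in T) => /=; case: c => *; rewrite ?muln0 ?mul1n /=; lia.
rewrite nb_moreS !nb_peaksS -[in iota _ v.+2](addn1 v.+1) iotaD count_cat add1n.
(* A peak step follows from the instance at [c.+1]. A non-peak step follows from twice the instance
   at [c] plus, for positive [c], the one at [c.-1]. The factor [c.+1] comes from the recurrence. *)
move: (IH c) (IH c.+1) (IH c.-1); set b := count _ (iota 1 v.+1).
rewrite /= add1n => /(congr1 (muln c.+1)) e0 /(congr1 (muln c.+1)) e1.
move=> /(congr1 (muln c.+1)) e2; case: (v.+2 \in T); move: e0 e1 e2; rewrite /=.
  by clear; lia.
by case: c => [|c] /=; clear; lia.
Qed.

Lemma uniq_heads (rs : seq (seq nat)) : [::] \notin rs -> uniq (flatten rs) ->
  uniq [seq head 0 r | r <- rs].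
Proof.
elim: rs => //= r rs IH; rewrite inE negb_or cat_uniq => /andP[r0 rs0].
case/and3P=> _ disj /(IH rs0)->; rewrite andbT; apply/mapP => -[s s_rs eq_h].
move/hasPn: disj => /(_ (head 0 s)).
rewrite -{2}eq_h; case: r {IH} r0 eq_h => //= x r _ _; rewrite mem_head.
case: s s_rs => [|y s] s_rs; first by rewrite s_rs in rs0.
by move=> /=; case/(_ _)/negP => //; apply/flattenP; exists (y :: s); rewrite ?mem_head.
Qed.

(** * Peaks of the run-sorted word *)

Lemma PKVP (w : seq nat) (x : nat) :
  reflect (exists w1 a b w2, [/\ w = w1 ++ [:: a, x, b & w2], a < x & b < x])
          (x \in PKV w).
Proof.
apply: (iffP idP).
  case/imfsetP => i /=; rewrite inE mem_iota => /andP[_ /and4P[i0 iw lt1 lt2]] ->.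
  exists (take i.-1 w), (nth 0 w i.-1), (nth 0 w i.+1), (drop i.+2 w); split=> //.
  rewrite -{1}(cat_take_drop i.-1 w) (drop_nth 0); last by lia.
  by rewrite prednK // (drop_nth 0) ?(drop_nth 0 iw) //; lia.
case=> w1 [a] [b] [w2] [-> ax bx]; set s := [:: a, x, b & w2].
have nthE k : nth 0 (w1 ++ s) (size w1 + k) = nth 0 s k.
  by rewrite nth_cat ltnNge leq_addr addKn.
apply/imfsetP => /=; exists (size w1 + 1); last by rewrite nthE.
rewrite inE mem_iota /is_peak size_cat -addnS !nthE addn1 /=.
by have := nthE 0; rewrite addn0 => -> /=; rewrite ax bx; lia.
Qed.

Lemma sorted_infix3 (r1 r2 : seq nat) x y : sorted ltn (r1 ++ [:: x, y & r2]) -> x < y.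
Proof. by case/cat_sorted2 => _ /andP[]. Qed.

(** Descents occur only at ends of runs, and the next head is the least one exceeding [head 0 r]; it
    lies below [x] as soon as some larger head does. The criterion ignores the order of the runs, so
    it can be tested on the unsorted permutation and on partial ones. *)
Lemma mem_PKV_flatten (rs : seq (seq nat)) (x : nat) :
  [::] \notin rs -> all (sorted ltn) rs -> sorted ltn [seq head 0 r | r <- rs] ->
  (x \in PKV (flatten rs)) =
  has (fun r => (last 0 r == x) && has (fun s => head 0 r < head 0 s < x) rs) rs.
Proof.
move=> rs0 rs_sorted rs_heads; apply/PKVP/hasP.
  case=> w1 [a] [b] [w2] [].
  elim: rs w1 rs0 rs_sorted rs_heads => [|r rs IH] w1 /=; first by case: w1.
  rewrite inE negb_or => /andP[r0 rs0] /andP[r_sorted rs_sorted] rs_heads eq_w ax bx.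
  have [le_r|lt_r] := leqP (size r) (size w1).
    have [w1' ew1] : exists w1', w1 = r ++ w1'.
      exists (drop (size r) w1); rewrite -{1}(cat_take_drop (size r) w1); congr cat.
      by rewrite -(takel_cat [:: a, x, b & w2] le_r) -eq_w take_size_cat.
    move/eqP: eq_w; rewrite ew1 -catA eqseq_cat // eqxx /= => /eqP eq_w.
    case: (IH w1' rs0 rs_sorted (path_sorted rs_heads) eq_w ax bx) => s s_rs.
    case/andP=> s_x /hasP[t t_rs t_x]; exists s; first by rewrite inE s_rs orbT.
    by rewrite s_x /=; apply/orP; right; apply/hasP; exists t.
  have [r' er] : exists r', r = w1 ++ a :: r'.
    exists (drop (size w1).+1 r).
    rewrite -cat_rcons -{1}(cat_take_drop (size w1).+1 r); congr cat.
    rewrite -(takel_cat (flatten rs) lt_r) eq_w -cat_rcons.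
    by rewrite take_size_cat ?size_rcons.
  move: eq_w r_sorted rs_heads; rewrite {}er -catA {r r0 lt_r IH} => /eqP.
  rewrite eqseq_cat // eqxx /= => /eqP.
  (* If [x] is followed by [b] in its own run, then x < b. If [x] starts the next run, what follows
     is larger, be it in that run or the head of another. Only [x] ending the run of [a] remains. *)
  case: r' => [|y [|z r']] /=; last 1 first.
  - by move=> [-> -> _] /cat_sorted2[_] /= /and3P[_ xb _]; lia.
  - case: rs rs0 rs_sorted => [|[|x' [|b' s]] rs] // rs0 /andP[s_sorted _] /=; last first.
      by move=> [ex eb _]; move: s_sorted; rewrite ex eb => /andP[xb _]; lia.
    case: rs rs0 {s_sorted} => [|[|b' s] rs] //= _ [-> -> _] _.
    by case/and3P=> _ xb _; lia.
  move=> [-> eq_w] r_sorted rs_heads; exists (w1 ++ [:: a; x]).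
    by rewrite mem_head.
  rewrite last_cat eqxx /=; apply/orP; right.
  case: rs rs0 {rs_sorted} rs_heads eq_w => [|[|b' s] rs] //= _ /andP[hb _] [eb _].
  by rewrite hb eb bx.
case=> r r_rs /andP[/eqP last_r /hasP[s s_rs /andP[rs_lt sx]]].
case/splitPr: r_rs s_rs rs0 rs_sorted rs_heads => A B.
rewrite mem_cat inE map_cat all_cat mem_cat inE !negb_or /= => s_in.
case/and3P=> _ r0 B0 /and3P[_ r_sorted _].
rewrite sorted_cat_cons; case/andP.
rewrite (sorted_pairwise ltn_trans) pairwise_rcons => /andP[/allP A_lt _].
have {A_lt}s_in : s \in B.
  case/or3P: s_in => [s_A|/eqP es|//]; last by rewrite es ltnn in rs_lt.
  by have := A_lt _ (map_f _ s_A); lia.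
(* [b] is the head of the run after [r], hence at most that of [s], hence below [x]. *)
case: B B0 s_in => [|[|b t] B] // B0 s_in /andP[_ B_lt].
have bx : b < x.
  move: s_in; rewrite inE => /orP[/eqP es|s_B]; first by rewrite es in sx.
  have /allP/(_ _ (map_f _ s_B)) := order_path_min ltn_trans B_lt.
  by move=> /= bs; apply: ltn_trans bs sx.
case/lastP: r r_sorted last_r rs_lt {r0 B_lt} => [|r y].
  by move=> _ /= x0; rewrite -x0 in sx.
rewrite last_rcons => r_sorted eyx; subst y.
case/lastP: r r_sorted => [|r a] /=; first by lia.
rewrite -!cats1 -catA => /sorted_infix3 ax _.
exists (flatten A ++ r), a, b, (t ++ flatten B); split=> //.
by rewrite flatten_cat /= -!catA.
Qed.

Lemma mem_PKV_runsort (w : seq nat) (x : nat) : uniq w ->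
  (x \in PKV (runsort_word w)) =
  has (fun r => (last 0 r == x) && has (fun s => head 0 r < head 0 s < x) (runs w))
    (runs w).
Proof.
move=> w_uniq; set leh := fun r s : seq nat => head 0 r <= head 0 s.
have perm_s : sort leh (runs w) =i runs w by move=> r; rewrite mem_sort.
rewrite /runsort_word mem_PKV_flatten ?perm_s ?runs_neq_nil //.
- rewrite (eq_has_r perm_s); apply: eq_has => r.
  by rewrite (eq_has_r perm_s).
- by rewrite (eq_all_r perm_s) sorted_runs.
rewrite ltn_sorted_uniq_leq uniq_heads /=; last 2 first.
- by rewrite perm_s runs_neq_nil.
- by rewrite (perm_uniq (perm_runsort_word w)).
rewrite sorted_map; apply: sort_sorted => r s; exact: leq_total.
Qed.

(** * Permutations as closed states *)

Definition linked (b b' : block) := b.1 || (bhead b' <= last 0 b.2).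

Definition valid (v : nat) (bl : seq block) : bool :=
  [&& perm_eq (word bl) (iota 1 v), all (fun b => b.2 != [::]) bl,
      all (fun b => sorted ltn b.2) bl & sorted linked bl].

(** The criterion of [mem_PKV_flatten], restricted to closed runs: the last entry of an open run
    will be followed by a larger one. *)
Definition peak_in (bl : seq block) (x : nat) : bool :=
  has (fun b => [&& ~~ b.1, last 0 b.2 == x &
                 has (fun b' => bhead b < bhead b' < x) bl]) bl.

(** In decreasing order, because [children] puts each new peak-value in front. *)
Definition peaks_upto (v : nat) (bl : seq block) : seq nat :=
  [seq x <- rev (iota 1 v) | peak_in bl x].

Definition max_head (bl : seq block) : nat := \max_(b <- bl) bhead b.

Lemma mem_word (bl : seq block) (b : block) (x : nat) :
  b \in bl -> x \in b.2 -> x \in word bl.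
Proof. by move=> b_bl x_b; apply/flattenP; exists b.2; rewrite ?map_f. Qed.

Lemma word_cat (bl bl' : seq block) : word (bl ++ bl') = word bl ++ word bl'.
Proof. by rewrite /word /unzip2 map_cat flatten_cat. Qed.

Lemma bhead_mem (b : block) : b.2 != [::] -> bhead b \in b.2.
Proof. by case: b => o [|x r] //= _; rewrite mem_head. Qed.

Lemma last_mem (b : block) : b.2 != [::] -> last 0 b.2 \in b.2.
Proof. by case: b => o [|x r] //= _; rewrite mem_last. Qed.

(** An insertion is undone. The largest value [v.+1] ends its run. If other entries remain, the run
    becomes open; otherwise it disappears, and the block before it, if any, must be open because its
    last entry is at most [v]. *)
Lemma valid_block v bl : valid v.+1 bl ->
  exists X o r Y, [/\ bl = X ++ (o, rcons r v.+1) :: Y,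
     all (fun b => last 0 b.2 <= v) (X ++ Y),
     all (fun b => bhead b <= v) (X ++ Y),
     perm_eq (word X ++ r ++ word Y) (iota 1 v) &
     valid v (if r is [::] then X ++ Y else X ++ (true, r) :: Y)].
Proof.
case/and4P=> perm_bl nn srt lnk.
have /flattenP[r' /mapP[[o r] b_bl /= ->] v_r] : v.+1 \in word bl.
  by rewrite (perm_mem perm_bl) mem_iota; lia.
case/splitPr: v_r b_bl => p q b_bl.
case: q b_bl => [|y q] b_bl; last first.
  have: sorted ltn (p ++ [:: v.+1, y & q]) by exact: (allP srt _ b_bl).
  move=> /sorted_infix3 vy.
  have : y \in word bl by apply: mem_word b_bl _; rewrite mem_cat !inE eqxx !orbT.
  by rewrite (perm_mem perm_bl) mem_iota; lia.
case/splitPr: b_bl perm_bl nn srt lnk => X Y.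
rewrite cats1 word_cat /= !all_cat sorted_cat_cons /= => perm_bl.
case/and3P=> nX _ nY /and3P[sX sp sY] /andP[lX lY].
have perm_v : perm_eq (word X ++ p ++ word Y) (iota 1 v).
  have e : perm_eq (iota 1 v.+1) (v.+1 :: iota 1 v).
    by rewrite -[in iota _ v.+1](addn1 v) iotaD add1n perm_catC.
  rewrite -(perm_cons v.+1); apply: perm_trans (perm_trans perm_bl e).
  by apply/seq.permP => a; rewrite /word -cats1 /= !count_cat /=; lia.
have leXY : all (fun b => (last 0 b.2 <= v) && (bhead b <= v)) (X ++ Y).
  apply/allP => b b_XY.
  have nb : b.2 != [::] by move: b_XY; rewrite mem_cat => /orP[/(allP nX)|/(allP nY)].
  have le_v x : x \in b.2 -> x <= v.
    move=> x_b; have : x \in word X ++ p ++ word Y.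
      by rewrite mem_cat mem_cat orbCA -mem_cat -word_cat (mem_word b_XY x_b) orbT.
    by rewrite (perm_mem perm_v) mem_iota; lia.
  by rewrite !le_v ?last_mem ?bhead_mem.
exists X, o, p, Y; split=> //.
- by apply: sub_all leXY => b /andP[].
- by apply: sub_all leXY => b /andP[].
case: p perm_bl sp lX lY perm_v => [|a p] perm_bl sp lX lY perm_v; last first.
  rewrite /valid word_cat perm_v !all_cat /= nX nY sX sY sorted_cat_cons /=.
  have -> : path ltn a p by move: sp; rewrite -cats1 => /cat_sorted2[].
  rewrite (_ : path _ _ Y); last by case: Y lY {nY sY leXY perm_bl perm_v} => //= y Y /andP[].
  rewrite andbT /=; case: X lX {perm_bl nX sX perm_v leXY} => //= x X.
  by rewrite !rcons_path andbT.
rewrite /valid word_cat perm_v !all_cat nX nY sX sY /=.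
case/lastP: X lX leXY {perm_bl nX sX perm_v} => [|X x]; first by move: lY => /path_sorted.
rewrite -[rcons (rcons X x) _]cats1 !cat_rcons sorted_cat_cons => /andP[lX /andP[lx _]] /allP leXY.
rewrite sorted_cat_cons lX /=.
have x1 : x.1.
  move: lx; rewrite /linked /bhead /= => /orP[//|lt_x].
  have := leXY x; rewrite mem_cat mem_head orbT => /(_ isT); lia.
by case: Y lY {leXY nY sY} => //= y Y /andP[_ ->]; rewrite /linked x1.
Qed.

Lemma peaks_uptoS v bl : peaks_upto v.+1 bl =
  if peak_in bl v.+1 then v.+1 :: peaks_upto v bl else peaks_upto v bl.
Proof. by rewrite /peaks_upto -[in iota _ v.+1](addn1 v) iotaD rev_cat add1n. Qed.

Lemma eq_peaks_upto v bl bl' : {in [pred x | x <= v], peak_in bl =1 peak_in bl'} ->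
  peaks_upto v bl = peaks_upto v bl'.
Proof.
by move=> e; apply: eq_in_filter => x; rewrite mem_rev mem_iota => x_v; apply: e; rewrite inE; lia.
Qed.

Lemma max_head_cat bl bl' : max_head (bl ++ bl') = maxn (max_head bl) (max_head bl').
Proof. by rewrite /max_head big_cat. Qed.

Lemma max_head_cons b bl : max_head (b :: bl) = maxn (bhead b) (max_head bl).
Proof. by rewrite /max_head big_cons. Qed.

Lemma max_head_le v bl : all (fun b => bhead b <= v) bl -> max_head bl <= v.
Proof. by move=> /allP le_v; apply/bigmax_leqP_seq => b /le_v. Qed.

Lemma has_max_head x bl :
  has (fun b => x < bhead b) bl = (x < max_head bl).
Proof.
by elim: bl => [|b bl IH]; rewrite /max_head ?big_nil //= big_cons leq_max -IH.
Qed.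

Lemma sub_children v h pk X r Y :
  {subset [:: (h, if head 0 r == h then pk else v :: pk, X ++ (false, rcons r v) :: Y);
        (h, pk, X ++ (true, rcons r v) :: Y);
        (v, pk, X ++ [:: (true, r), (false, [:: v]) & Y]);
        (v, pk, X ++ [:: (true, r), (true, [:: v]) & Y])] <=
   children v (h, pk, X ++ (true, r) :: Y)}.
Proof.
move=> s s_in; rewrite mem_cat; apply/orP; right; apply/flatten_mapP.
by exists (X, r, Y) => //; apply/open_splitsP.
Qed.

(** Removing [v.+1] gives the parent state by induction; it remains to see that the recorded head
    and peaks evolve as in [children]. Membership alone is shown: multiplicities are settled by
    counting in [perm_closed_levels]. *)
Lemma mem_levels v bl : valid v bl ->
  (max_head bl, peaks_upto v bl, bl) \in levels v.
Proof.
elim: v bl => [|v IH] bl bl_valid.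
  case: bl bl_valid => [|[o [|x r]] bl] /and4P[] //=; first by rewrite /max_head big_nil.
  by move/perm_size.
have [X [o [r [Y [ebl lastXY headXY perm_v /IH par]]]]] := valid_block bl_valid.
apply/flatten_mapP; eexists; first exact: par.
move: lastXY headXY; rewrite !all_cat => /andP[lX lY] /andP[hX hY].
have no_last Z x P : all (fun b => last 0 b.2 <= v) Z ->
   v < x -> has (fun b : block => [&& ~~ b.1, last 0 b.2 == x & P b]) Z = false.
  move=> /allP lZ vx; apply/hasPn => b /lZ le; rewrite !negb_and.
  by rewrite (ltn_eqF (leq_ltn_trans le vx)) orbT.
case: r ebl perm_v {par} => [|a r] ebl perm_v; rewrite [rcons _ _]/= in ebl.
  (* Here [v.+1] forms a run by itself; its head is too large to lie strictly below any [x] in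
     range, so it affects no peak. *)
  have e x : x <= v -> peak_in bl x = peak_in (X ++ Y) x.
    move=> xv; have hE b : has (fun b' => bhead b < bhead b' < x) bl =
        has (fun b' => bhead b < bhead b' < x) (X ++ Y).
      rewrite ebl !has_cat /= [bhead (_, [:: v.+1])]/bhead /=.
      by rewrite [v.+1 < x]ltnNge (leq_trans xv) ?andbF.
    rewrite /peak_in; under eq_has => b do rewrite hE.
    by rewrite ebl !has_cat /= [v.+1 == x]gtn_eqF ?andbF.
  have -> : peaks_upto v.+1 bl = peaks_upto v (X ++ Y).
    rewrite peaks_uptoS (eq_peaks_upto e) ifF //.
    rewrite /peak_in ebl has_cat /= !no_last // orbF.
    rewrite [has _ (_ ++ _)](_ : _ = false) ?andbF //.
    by apply/hasPn => b _; rewrite /bhead /=; lia.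
  have -> : max_head bl = v.+1.
    rewrite ebl max_head_cat max_head_cons [bhead _]/=.
    have := max_head_le hX; have := max_head_le hY; rewrite /bhead /=; lia.
  move: (max_head _) (peaks_upto _ _) => h pk; move: bl_valid lX.
  rewrite ebl; case/lastP: X {ebl hX e perm_v} => [|X [o' w]].
    by move=> _ _; rewrite mem_cat !inE; case: (o); rewrite eqxx ?orbT.
  case/and4P=> _ _ _; rewrite -cats1 -!catA !cat1s sorted_cat_cons => /and3P[_ lnk _].
  rewrite all_cat /= => /and3P[_ lw _].
  have -> : o' = true by move: lnk; rewrite /linked /bhead /= => /orP[//|]; lia.
  by apply: sub_children; rewrite !inE; case: (o); rewrite eqxx ?orbT.
set bl0 := X ++ (true, a :: r) :: Y.
have hE x y : has (fun b' => x < bhead b' < y) bl = has (fun b' => x < bhead b' < y) bl0.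
  by rewrite ebl !has_cat.
have e x : x <= v -> peak_in bl x = peak_in bl0 x.
  move=> xv; rewrite /peak_in; under eq_has => b do rewrite hE.
  rewrite ebl !has_cat /= last_rcons [v.+1 == x]gtn_eqF ?andbF //.
have maxE : max_head bl = max_head bl0.
  by rewrite ebl /bl0 !max_head_cat !max_head_cons.
have av : a <= v.
  have : a \in iota 1 v by rewrite -(perm_mem perm_v) !(mem_cat, inE) eqxx orbT.
  by rewrite mem_iota; lia.
have h0 : all (fun b => bhead b <= v) bl0 by rewrite all_cat /= hX hY andbT.
(* All heads are at most [v], so the upper bound in the criterion is void and a head above [a]
   exists iff [a] is not the largest. *)
have peakE : peak_in bl v.+1 = ~~ o && (a != max_head bl0).
  rewrite /peak_in; under eq_has => b do rewrite hE.
  rewrite ebl has_cat /= !no_last // orbF last_rcons eqxx /=.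
  congr (_ && _); rewrite /bhead /=.
  have -> : has (fun b' => a < head 0 b'.2 < v.+1) bl0 = has (fun b' => a < bhead b') bl0.
    by apply: eq_in_has => b /(allP h0); rewrite /bhead; lia.
  rewrite has_max_head ltn_neqAle /max_head.
  suff -> : a <= \max_(b <- bl0) bhead b by rewrite andbT.
  by rewrite -/(max_head bl0) max_head_cat max_head_cons /bhead /=; lia.
rewrite maxE peaks_uptoS (eq_peaks_upto e) peakE ebl.
apply: sub_children; rewrite !inE; case: (o); rewrite /= ?eqxx ?orbT //.
by case: (a == _); rewrite /= eqxx.
Qed.

Lemma perm_one_line m (p : 'S_m) : perm_eq (one_line p) (iota 1 m).
Proof.
apply: uniq_perm; rewrite ?iota_uniq //.
  by rewrite map_inj_uniq ?enum_uniq // => i j [/val_inj/perm_inj].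
move=> x; rewrite mem_iota add1n ltnS; apply/mapP/andP => [[i _ ->]|[x0 xm]].
  by rewrite ltn_ord.
have xm' : x.-1 < m by rewrite prednK.
by exists (p^-1%g (Ordinal xm')); rewrite ?mem_enum // permKV /= prednK.
Qed.

Lemma one_line_inj m : injective (@one_line m).
Proof.
move=> p q /eq_in_map eq_pq; apply/permP => i; apply: val_inj.
by have [] := eq_pq i (mem_enum _ i).
Qed.

Definition run_blocks (w : seq nat) : seq block := [seq (false, r) | r <- runs w].

Definition run_state m (p : 'S_m) : state :=
  let bl := run_blocks (one_line p) in (max_head bl, peaks_upto m bl, bl).

Lemma word_run_blocks w : word (run_blocks w) = w.
Proof. by rewrite /word /unzip2 -map_comp map_id flatten_runs. Qed.

Lemma valid_run_blocks m (p : 'S_m) : valid m (run_blocks (one_line p)).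
Proof.
rewrite /valid word_run_blocks perm_one_line !all_map sorted_map /=; apply/and3P; split.
- by apply/allP => r r_w /=; apply: contraNneq (runs_neq_nil (one_line p)) => <-.
- exact: sorted_runs.
- exact: maximal_runs.
Qed.

(* Every permutation occurs among the closed states, and there are only n! of these;
   hence none is missing or repeated. *)
Lemma perm_closed_levels n :
  perm_eq [seq s <- levels n.+1 | nb_open s == 0]
          [seq run_state p | p <- enum 'S_n.+1].
Proof.
have uniq_runs : uniq [seq run_state p | p <- enum 'S_n.+1].
  rewrite map_inj_uniq ?enum_uniq // => p q [_ _] /(congr1 word).
  by rewrite !word_run_blocks => /one_line_inj.
have sub_runs : {subset [seq run_state p | p <- enum 'S_n.+1]
                   <= [seq s <- levels n.+1 | nb_open s == 0]}.
  move=> _ /mapP[p _ ->]; rewrite mem_filter mem_levels ?valid_run_blocks // andbT.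
  by rewrite /nb_open /= count_map count_pred0.
have size_closed : size [seq s <- levels n.+1 | nb_open s == 0] = n.+1`!.
  rewrite size_filter -[RHS]muln1 -(bin0 n) -nb_closed_total.
  apply: eq_count => s; rewrite /in_class /allowed all_predT /=.
  case: eqP => //= s0; symmetry; rewrite -leqn0 -s0.
  by apply: sub_count => b /andP[].
have size_runs : size [seq run_state p | p <- enum 'S_n.+1] = n.+1`!.
  by rewrite size_map -cardE card_Sn.
rewrite perm_sym; apply: uniq_perm => //.
  by apply: (leq_size_uniq uniq_runs sub_runs); rewrite size_closed size_runs.
by have [] := uniq_min_size uniq_runs sub_runs; rewrite ?size_closed ?size_runs.
Qed.

Lemma PKV_sub (w : seq nat) x : x \in PKV w -> x \in w.
Proof. by case/PKVP => w1 [a] [b] [w2] [-> _ _]; rewrite mem_cat !inE eqxx !orbT. Qed.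

Lemma SPV_le m (p : 'S_m) x : x \in SPV p -> 0 < x <= m.
Proof.
move/PKV_sub; rewrite (perm_mem (perm_runsort_word _)) (perm_mem (perm_one_line p)).
by rewrite mem_iota.
Qed.

Lemma peak_in_run_blocks m (p : 'S_m) x :
  peak_in (run_blocks (one_line p)) x = (x \in SPV p).
Proof.
rewrite mem_PKV_runsort ?(perm_uniq (perm_one_line p)) ?iota_uniq //.
rewrite /peak_in has_map; apply: eq_has => r /=; congr andb.
by rewrite has_map; apply: eq_has.
Qed.

(** [nb_peaks T n] concerns the values up to [n.+1]. As [allowed] inspects only those, the bound on
    [T] makes the test equivalent to equality of sets. With no open run, [nb_latest] is 0
    automatically. *)
Lemma count_SPV n (T : {fset nat}) : (forall x, x \in T -> 0 < x <= n.+1) ->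
  count (fun p => SPV p == T) (enum 'S_n.+1) = nb_peaks T n 0.
Proof.
move=> T_le; transitivity (count (fun s => allowed (has_peaks T) n.+1 s.1.2)
    [seq s <- levels n.+1 | nb_open s == 0]); last first.
  rewrite count_filter; apply: eq_count => s; rewrite /in_class /=; congr andb.
  case: eqP => //= s0; symmetry; rewrite -leqn0 -s0.
  by apply: sub_count => b /andP[].
rewrite (seq.permP (perm_closed_levels n)) [RHS]count_map; apply: eq_count => p /=.
have pkE i : 0 < i <= n.+1 ->
    (i \in peaks_upto n.+1 (run_blocks (one_line p))) = (i \in SPV p).
  by move=> i_n; rewrite mem_filter mem_rev mem_iota i_n andbT peak_in_run_blocks.
apply/eqP/allP => [<- i|eq_T].
  by rewrite mem_iota => i_n; rewrite /has_peaks pkE // eqxx.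
apply/fsetP => i; case: (boolP (0 < i <= n.+1)) => i_n.
  by rewrite -pkE //; apply/eqP/eq_T; rewrite mem_iota.
by apply/idP/idP => [/SPV_le|/T_le]; rewrite (negPf i_n).
Qed.

Lemma mem_PKV_nth (w : seq nat) j : uniq w -> j < size w ->
  (nth 0 w j \in PKV w) = is_peak w j.
Proof.
move=> w_uniq j_w; apply/imfsetP/idP => [[i /=]|j_peak].
  rewrite inE mem_iota => /andP[/andP[_ i_w] i_peak] /eqP.
  by rewrite nth_uniq // => /eqP->.
by exists j => //; rewrite inE mem_iota add0n j_w.
Qed.

(** * Counting the pairs (a, pi) *)

(** Prescriptions (3) to (5). For adjacent [a] and [k] the order of the tests is immaterial, by
    [PKV_nonadjacent]. *)
Definition insert_peaks (S : {fset nat}) (n a k : nat) : {fset nat} :=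
  if a \in S then ((S `\ a) `|` [fset n])%fset
  else if k \in S then ((S `\ k) `|` [fset n])%fset else (S `|` [fset n])%fset.

Definition new_peaks (n : nat) (w : seq nat) (a : nat) : {fset nat} :=
  if a == last 0 w then PKV w
  else insert_peaks (PKV w) n a (nth 0 w (index a w).+1).

Lemma fsetU1_eq (A B : {fset nat}) n : n \notin A -> n \in B ->
  ((A `|` [fset n])%fset == B) = (A == (B `\ n)%fset).
Proof.
move=> nA nB; apply/eqP/eqP => [<-|->]; apply/fsetP => x.
  rewrite in_fsetD1 in_fsetU in_fset1; case: eqP => [->|_] /=; rewrite ?orbF //.
  exact: negbTE.
by rewrite in_fsetU in_fset1 in_fsetD1; case: eqP => [->|_]; rewrite ?nB ?orbF.
Qed.

Lemma fsetD1_eq (A B : {fset nat}) x :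
  (x \in A) && ((A `\ x)%fset == B) = (x \notin B) && (A == (B `|` [fset x])%fset).
Proof.
apply/andP/andP => [[xA /eqP<-]|[xB /eqP->]].
  rewrite in_fsetD1 eqxx; split=> //; apply/eqP/fsetP => y.
  by rewrite in_fsetU in_fset1 in_fsetD1; case: eqP => [->|_]; rewrite ?xA ?orbF.
rewrite in_fsetU in_fset1 eqxx orbT; split=> //; apply/eqP/fsetP => y.
rewrite in_fsetD1 in_fsetU in_fset1; case: eqP => [->|_] /=; rewrite ?orbF //.
by rewrite (negPf xB).
Qed.

Lemma sum_nth_recr (w : seq nat) k (h : nat -> nat) : size w = k.+1 ->
  \sum_(a <- w) h a = \sum_(0 <= j < k) h (nth 0 w j) + h (last 0 w).
Proof. by move=> w_k; rewrite (big_nth 0) w_k big_nat_recr // -nth_last w_k. Qed.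

Lemma sum_nth_recl (w : seq nat) k (h : nat -> nat) : size w = k.+1 ->
  \sum_(a <- w) h a = h (nth 0 w 0) + \sum_(0 <= j < k) h (nth 0 w j.+1).
Proof. by move=> w_k; rewrite (big_nth 0) w_k big_nat_recl. Qed.

Lemma peak_nth (w : seq nat) k j : perm_eq w (iota 1 k.+1) -> j <= k ->
  (nth 0 w j \in PKV w) = is_peak w j.
Proof.
move=> w_perm jk; rewrite mem_PKV_nth ?(perm_uniq w_perm) ?iota_uniq //.
by rewrite (perm_size w_perm) size_iota.
Qed.

Lemma first_notin_PKV (w : seq nat) k : perm_eq w (iota 1 k.+1) ->
  nth 0 w 0 \notin PKV w.
Proof. by move=> w_perm; rewrite (peak_nth w_perm). Qed.

Lemma last_notin_PKV (w : seq nat) k : perm_eq w (iota 1 k.+1) ->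
  last 0 w \notin PKV w.
Proof.
move=> w_perm; have w_size := perm_size w_perm; rewrite size_iota in w_size.
by rewrite -nth_last w_size (peak_nth w_perm) // /is_peak w_size ltnn andbF.
Qed.

Lemma PKV_nonadjacent (w : seq nat) k j : perm_eq w (iota 1 k.+1) -> j < k ->
  ~~ ((nth 0 w j \in PKV w) && (nth 0 w j.+1 \in PKV w)).
Proof.
move=> w_perm jk; rewrite !(peak_nth w_perm) //; last exact: ltnW.
apply/negP => /andP[/and4P[_ _ _ lt1] /and4P[_ _ lt2 _]].
by move: lt1 lt2; rewrite /=; lia.
Qed.

Lemma new_notin_PKV (w : seq nat) k : perm_eq w (iota 1 k.+1) -> k.+2 \notin PKV w.
Proof. by move=> w_perm; apply/negP => /PKV_sub; rewrite (perm_mem w_perm) mem_iota; lia. Qed.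

Lemma new_peaks_last n (w : seq nat) : new_peaks n w (last 0 w) = PKV w.
Proof. by rewrite /new_peaks eqxx. Qed.

Lemma new_peaks_nth n (w : seq nat) k j : perm_eq w (iota 1 k.+1) -> j < k ->
  new_peaks n w (nth 0 w j) = insert_peaks (PKV w) n (nth 0 w j) (nth 0 w j.+1).
Proof.
move=> w_perm jk; have w_size := perm_size w_perm; rewrite size_iota in w_size.
have w_uniq : uniq w by rewrite (perm_uniq w_perm) iota_uniq.
rewrite /new_peaks index_uniq ?w_size ?(leqW jk) //.
by rewrite -nth_last w_size nth_uniq ?w_size ?(leqW jk) // ltn_eqF.
Qed.

Lemma count_new_peaks (w : seq nat) k (T : {fset nat}) : perm_eq w (iota 1 k.+1) ->
  count (fun a => new_peaks k.+2 w a == T) w =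
  \sum_(0 <= j < k) (insert_peaks (PKV w) k.+2 (nth 0 w j) (nth 0 w j.+1) == T)
  + (PKV w == T).
Proof.
move=> w_perm; have w_size := perm_size w_perm; rewrite size_iota in w_size.
rewrite -sum_bool (sum_nth_recr _ w_size) new_peaks_last; congr (_ + _).
by apply: eq_big_nat => j /andP[_ jk]; rewrite (new_peaks_nth _ w_perm).
Qed.

Lemma count_new_peaks_out (w : seq nat) k (T : {fset nat}) :
  perm_eq w (iota 1 k.+1) -> k.+2 \notin T ->
  count (fun a => new_peaks k.+2 w a == T) w = (PKV w == T).
Proof.
move=> w_perm nT; rewrite (count_new_peaks _ w_perm) big1 // => j _.
suff /negPf-> : insert_peaks (PKV w) k.+2 (nth 0 w j) (nth 0 w j.+1) != T by [].
apply: contraNneq nT => <-; rewrite /insert_peaks.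
by do 2?case: ifP => _; rewrite in_fsetU in_fset1 eqxx orbT.
Qed.

(** There are [k] adjacent pairs, and each peak lies in exactly two. A pair without peak gives [T]
    iff the peak set is [U]; a pair containing the peak [x] does iff it is [U] with [x] added. The
    pairs to be discounted stand on the left to avoid subtraction. *)
Lemma count_new_peaks_in (w : seq nat) k (T : {fset nat}) :
  perm_eq w (iota 1 k.+1) -> k.+2 \in T -> let U := (T `\ k.+2)%fset in
  count (fun a => new_peaks k.+2 w a == T) w
    + 2 * count (fun x => x \in U) (iota 1 k.+1) * (PKV w == U)
  = k * (PKV w == U)
    + 2 * \sum_(x <- iota 1 k.+1 | x \notin U) (PKV w == (U `|` [fset x])%fset).
Proof.
move=> w_perm nT U; set S := PKV w; rewrite (count_new_peaks _ w_perm) -/S.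
have w_size := perm_size w_perm; rewrite size_iota in w_size.
have new_fresh := new_notin_PKV w_perm.
have -> : (S == T) = false by apply: contraNF new_fresh => /eqP; rewrite /S => ->.
(* The first and last entries are not peaks, so every entry that contributes belongs to two adjacent
   pairs. *)
have sumE (h : nat -> nat) : (forall x, x \notin S -> h x = 0) ->
    2 * \sum_(x <- iota 1 k.+1) h x =
    \sum_(0 <= j < k) (h (nth 0 w j) + h (nth 0 w j.+1)).
  move=> h0; rewrite -(perm_big _ w_perm) big_split /= mul2n -addnn.
  rewrite {1}(sum_nth_recr _ w_size) (sum_nth_recl _ w_size).
  by rewrite (h0 _ (first_notin_PKV w_perm)) (h0 _ (last_notin_PKV w_perm)) addn0.
have -> : 2 * count (fun x => x \in U) (iota 1 k.+1) * (S == U) =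
    2 * \sum_(x <- iota 1 k.+1) (x \in S) * (S == U).
  rewrite -big_distrl /= sum_bool; case: eqP => [->|_]; rewrite ?muln1 ?muln0 //.
have -> : \sum_(x <- iota 1 k.+1 | x \notin U) (S == (U `|` [fset x])%fset) =
    \sum_(x <- iota 1 k.+1) (x \in S) * ((S `\ x)%fset == U).
  rewrite big_mkcond; apply: eq_bigr => x _.
  by rewrite mulnb fsetD1_eq; case: (x \notin U).
rewrite !sumE; try by move=> x /negPf->.
have -> : k * (S == U) = \sum_(0 <= j < k) (S == U).
  by rewrite sum_nat_const_nat subn0.
rewrite addn0 -!big_split; apply: eq_big_nat => j /andP[_ jk] /=.
have := PKV_nonadjacent w_perm jk; rewrite -/S /insert_peaks.
have fresh x : k.+2 \notin (S `\ x)%fset.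
  by rewrite in_fsetD1 (negPf new_fresh) andbF.
case: (nth 0 w j \in S) => [/= /negPf->|_]; last case: (nth 0 w j.+1 \in S).
- by rewrite fsetU1_eq // -/U !(mul1n, mul0n, addn0) addnC.
- by rewrite fsetU1_eq // -/U !(mul1n, mul0n, addn0, add0n) addnC.
by rewrite fsetU1_eq ?new_fresh // -/U !(mul1n, mul0n, addn0, add0n).
Qed.

(** * Comparison of the two counts *)

Lemma enum_option_prod (X Y : finType) (q : pred (option X * Y)) :
  count q (enum {: option X * Y}) =
  \sum_(y <- enum Y) (q (None, y) + count (fun x => q (Some x, y)) (enum X)).
Proof.
rewrite -sum_bool big_enum /= (eq_bigr (fun u => nat_of_bool (q (u.1, u.2)))); last by case.
rewrite -(pair_bigA _ (fun o y => nat_of_bool (q (o, y)))) /=.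
rewrite exchange_big -big_enum /=; apply: eq_bigr => y _.
rewrite -sum_bool big_enum /= (bigD1 None) //=; congr (_ + _).
rewrite (reindex_omap Some id) => [|[x|]] //=.
by apply: eq_bigl => x; rewrite eqxx.
Qed.

Definition target n (u : option 'I_n.-1 * 'S_n.-1) : {fset nat} :=
  if u.1 is Some i then new_peaks n (runsort u.2) i.+1 else SPV u.2.

Lemma perm_runsort m (p : 'S_m) : perm_eq (runsort p) (iota 1 m).
Proof. exact: perm_trans (perm_runsort_word _) (perm_one_line p). Qed.

Lemma count_ord m (q : pred nat) :
  count (fun i : 'I_m => q i.+1) (enum 'I_m) = count q (iota 1 m).
Proof.
rewrite -[LHS](count_map (fun i : 'I_m => i.+1) q); apply: seq.permP.
have := perm_one_line (1%g : 'S_m); rewrite /one_line.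
by under eq_map => i do rewrite perm1.
Qed.

Lemma SPV_small m (p : 'S_m) : m < 3 -> SPV p = fset0.
Proof.
move=> m3; apply/fsetP => x; rewrite in_fset0; apply/negP => /PKVP[w1 [a] [b] [w2] [ew _ _]].
have := perm_size (perm_runsort p); rewrite ew size_iota size_cat /=; lia.
Qed.

Lemma new_peaks_sub n w a x : x \in new_peaks n w a -> (x \in PKV w) || (x == n).
Proof.
rewrite /new_peaks /insert_peaks; do 3?case: ifP => _.
- by move->.
- by rewrite in_fsetU in_fsetD1 in_fset1 => /orP[/andP[_ ->]//|->]; rewrite orbT.
- by rewrite in_fsetU in_fsetD1 in_fset1 => /orP[/andP[_ ->]//|->]; rewrite orbT.
by rewrite in_fsetU in_fset1.
Qed.

Lemma target_le n (u : option 'I_n.-1 * 'S_n.-1) x : 0 < n ->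
  x \in target u -> 0 < x <= n.
Proof.
case: u => [[i|] p] n0; rewrite /target /=; last by move/SPV_le; lia.
by case/new_peaks_sub/orP => [/SPV_le|/eqP->]; lia.
Qed.

(** If [k.+2] is not in [z], only the empty choice and the last entry can give [z], which is the
    factor 2 of the non-peak recurrence at [c = 0]. Otherwise the sum of [count_new_peaks_in] over
    all permutations is compared with [nb_peaks_insert] at [c = 0]. *)
Lemma count_target k (z : {fset nat}) :
  (forall x, x \in z -> 0 < x <= k.+2) ->
  count (fun u => @target k.+2 u == z) (enum {: option 'I_k.+1 * 'S_k.+1}) =
  nb_peaks z k.+1 0.
Proof.
move=> z_le; rewrite enum_option_prod /target /=.
have cntE (p : 'S_k.+1) : count (fun i : 'I_k.+1 => new_peaks k.+2 (runsort p) i.+1 == z)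
    (enum 'I_k.+1) = count (fun a => new_peaks k.+2 (runsort p) a == z) (runsort p).
  rewrite (count_ord _ (fun a => new_peaks k.+2 (runsort p) a == z)).
  by rewrite (seq.permP (perm_runsort p)).
under eq_bigr => p _ do rewrite cntE; rewrite big_split /= sum_bool nb_peaksS.
case: (boolP (k.+2 \in z)) => nz; last first.
  under eq_bigr => p _ do rewrite (count_new_peaks_out (perm_runsort p) nz).
  rewrite sum_bool (count_SPV (n := k)); first by rewrite mul1n addn0 mul2n addnn.
  move=> x xz; have := z_le x xz; case: (eqVneq x k.+2) => [xk|]; last lia.
  by rewrite -xk xz in nz.
set U := (z `\ k.+2)%fset.
have U_le x : x \in U -> 0 < x <= k.+1.
  by rewrite in_fsetD1 => /andP[xk /z_le]; lia.
have -> : count (fun p : 'S_k.+1 => SPV p == z) (enum 'S_k.+1) = 0.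
  apply/eqP; rewrite -leqn0 leqNgt -has_count; apply/hasPn => p _.
  by apply: contraTneq nz => <-; apply/negP => /SPV_le; lia.
have : \sum_(p <- enum 'S_k.+1)
     count (fun a => new_peaks k.+2 (runsort p) a == z) (runsort p)
    + 2 * count (fun x => x \in U) (iota 1 k.+1) * nb_peaks U k 0 =
    k * nb_peaks U k 0 + 2 * nb_more U k 0.
  rewrite -(count_SPV U_le) -(sum_bool (fun p : 'S_k.+1 => SPV p == U)) !big_distrr -big_split /=.
  under eq_bigr => p _ do rewrite
    (count_new_peaks_in (perm_runsort p) nz).
  rewrite big_split /= -!big_distrr /= exchange_big /=. congr (_ + 2 * _).
  rewrite -[1 :: iota 2 k]/(iota 1 k.+1) big_seq_cond [RHS]big_seq_cond; apply: eq_bigr => x.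
  rewrite mem_iota => /andP[x_le xU]; rewrite sum_bool count_SPV // => y.
  by rewrite in_fsetU in_fset1 => /orP[/U_le|/eqP->] //; lia.
have := nb_peaks_insert U k 0.
have -> : nb_peaks z k 1 = nb_peaks U k 1.
  rewrite -(nb_peaksU_gt U 1 (ltnSn k.+1)); congr (nb_peaks _ _ _).
  by apply/eqP; rewrite eq_sym fsetU1_eq // in_fsetD1 eqxx.
(* The two identities differ by one copy of [nb_peaks U k 0]; the terms counting the elements of [U]
   cancel. *)
move=> e1 e2; rewrite add0n mul1n; apply: addIn (etrans e2 _); lia.
Qed.

Lemma count_fibers n z : 0 < n ->
  count (fun u => @target n u == z) (enum {: option 'I_n.-1 * 'S_n.-1}) =
  count (fun p => SPV p == z) (enum 'S_n).
Proof.
case: n => // -[|k] _ /=.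
  (* For n = 1 there is no entry to choose, all peak sets are empty, and both symmetric groups have
     one element. *)
  rewrite enum_option_prod /=.
  under eq_bigr => p _ do rewrite (size0nil (size_enum_ord 0)) addn0 /target /= SPV_small //.
  under [RHS]eq_count => p do rewrite SPV_small //.
  rewrite (sum_bool (fun _ => fset0 == z)) /=.
  case: eqP => _; rewrite ?count_predT ?count_pred0 //.
  by rewrite -!cardE !card_Sn.
have [z_le|z_nle] := boolP (all (fun x => 0 < x <= k.+2) z).
  by rewrite count_target ?count_SPV // => x /(allP z_le).
(* A set with an element outside 1, ..., n has an empty fiber on both sides. *)
have [x xz x_le] := allPn z_nle.
transitivity 0; last symmetry;
  apply/eqP; rewrite -leqn0 leqNgt -has_count; apply/hasPn => u _;
  apply: contraNneq x_le => ez; move: xz; rewrite -ez.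
- exact: target_le.
- exact: SPV_le.
Qed.

Lemma next_entryP (w : seq nat) a k : uniq w -> next_entry w a k ->
  [/\ a != last 0 w, (index a w).+1 < size w, nth 0 w (index a w) = a
    & nth 0 w (index a w).+1 = k].
Proof.
move=> w_uniq /infixP[s [t ew]]; move: w_uniq.
rewrite ew cat_uniq => /and3P[_ /hasPn/(_ a (mem_head _ _)) a_s /andP[a_t _]].
rewrite last_cat /=.
rewrite index_cat (negPf a_s) /= eqxx addn0 !nth_cat ltnn subnn.
rewrite [_.+1 < size s]ltnNge leqnSn /= subSnn size_cat /=; split=> //; last by lia.
by apply: contraNneq a_t => ->; apply: mem_last.
Qed.

Theorem theorem4p14 (n : nat) (hn : 1 <= n) :
  exists Phi : option 'I_(n.-1) * 'S_(n.-1) -> 'S_n,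
    bijective Phi /\
    forall p : 'S_(n.-1),
      SPV (Phi (None, p)) = SPV p /\
      forall i : 'I_(n.-1),
        let a := i.+1 in
        let q := Phi (Some i, p) in
        [/\ last 0 (runsort p) = a -> SPV q = SPV p,
            a \in SPV p -> SPV q = ((SPV p `\ a) `|` [fset n])%fset,
            forall k : nat, next_entry (runsort p) a k ->
              k \in SPV p -> SPV q = ((SPV p `\ k) `|` [fset n])%fset
          & forall k : nat, next_entry (runsort p) a k ->
              a \notin SPV p -> k \notin SPV p ->
              SPV q = (SPV p `|` [fset n])%fset].
Proof.
have [Phi [Phi_bij PhiE]] :=
  bij_of_fibers (1%g : 'S_n) (fun z => count_fibers z hn).
exists Phi; split=> // p; split; first exact: PhiE.
move=> i a q; rewrite /q PhiE /target /= -/a.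
(* The existence of [i] forces [n.-1] to be positive. *)
have [k m_k] : exists k, n.-1 = k.+1 by exists n.-1.-1; have := ltn_ord i; lia.
have w_perm : perm_eq (runsort p) (iota 1 k.+1) by rewrite -m_k perm_runsort.
have w_uniq : uniq (runsort p) by rewrite (perm_uniq w_perm) iota_uniq.
split=> [<-|aS|b ab bS|b ab aS bS].
- by rewrite new_peaks_last.
- rewrite /new_peaks /insert_peaks aS ifF //; apply: contraTF aS => /eqP->.
  exact: last_notin_PKV w_perm.
- have [a_last idx a_nth b_nth] := next_entryP w_uniq ab.
  rewrite /new_peaks (negPf a_last) b_nth /insert_peaks bS ifF //.
  rewrite (perm_size w_perm) size_iota ltnS in idx.
  (* The successor [b] is a peak, so [a] is not, and the first test of [insert_peaks] fails. *)
  by have := PKV_nonadjacent w_perm idx; rewrite a_nth b_nth [X in _ && X]bS andbT => /negPf.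
have [a_last idx a_nth b_nth] := next_entryP w_uniq ab.
by rewrite /new_peaks (negPf a_last) b_nth /insert_peaks (negPf aS) (negPf bS).
Qed.
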